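(* Let $k\ge 3$, let $1\le i\le n-2$, and let $H_1,\dots,H_k$ be $i$-dimensional linear subspaces of $\mathbb{R}^n$. Set $d=i$ and $M_j=H_j$ for all $j$ if $2\le i\le n/2$, and set $d=n-i$ and $M_j=H_j^\perp$ for all $j$ if $n/2<i\le n-2$. Assume that: (i) there exist an orthonormal basis $e_1,\dots,e_n$ of $\mathbb{R}^n$ and numbers $0<\alpha_1<\cdots<\alpha_d<\pi/2$ such that $\pi,\alpha_1,\dots,\alpha_d$ are linearly independent over $\mathbb{Q}$ and $$M_1=\mathrm{lin}\{e_1,e_3,\dots,e_{2d-1}\},\quad M_2=\mathrm{lin}\{\cos\alpha_j\, e_{2j-1}+\sin\alpha_j\, e_{2j}: j=1,\dots,d\},$$ $$M_3=\mathrm{lin}\big(\{\cos\alpha_1\, e_1+\sin\alpha_1\, e_{2d}\}\cup\{\cos\alpha_j\, e_{2j-1}+\sin\alpha_j\, e_{2j-2}: j=2,\dots,d\}\big);$$ (ii) $M_1+\cdots+M_k=\mathbb{R}^n$; (iii) for each $j=3,\dots,k-1$, $M_{j+1}\cap(M_1+\cdots+M_j)^\perp=\{o\}$. If $E\subset S^{n-1}$ is nonempty, closed, and such that $R_{H_j}E=E$ for $j=1,\dots,k$, then $E=S^{n-1}$.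
   Context: For a linear subspace $H$ of $\mathbb{R}^n$, $R_H$ is the reflection $x\mapsto 2(x|H)-x$, with $x|H$ the orthogonal projection onto $H$; $H^\perp$ is the orthogonal complement; $\mathrm{lin}$ denotes linear hull; $o$ is the origin; $S^{n-1}$ is the unit sphere. *)

(* Defs.v *)
From HB Require Import structures.
From mathcomp Require Import all_boot all_order all_algebra.
From mathcomp Require Import all_classical all_reals all_analysis.
Set Implicit Arguments. Unset Strict Implicit. Unset Printing Implicit Defensive.
Import Order.TTheory GRing.Theory Num.Theory.
Local Open Scope ring_scope.

(* Vectors of R^n are row vectors 'rV[R]_n; a linear subspace of R^n is
   represented by a matrix whose row space (mxalgebra, %MS) is the subspace. *)

Definition dotv (R : realType) (n : nat) (x y : 'rV[R]_n) : R := (x *m y^T) 0 0.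

Definition orthc (R : realType) (n m : nat) (H : 'M[R]_(m, n)) : 'M[R]_n :=
  kermx H^T.

Definition projv (R : realType) (n m : nat) (H : 'M[R]_(m, n)) (x : 'rV[R]_n)
  : 'rV[R]_n :=
  let B := row_base H in x *m (B^T *m invmx (B *m B^T) *m B).

Definition reflv (R : realType) (n m : nat) (H : 'M[R]_(m, n)) (x : 'rV[R]_n)
  : 'rV[R]_n := projv H x *+ 2 - x.

Definition lin (R : realType) (n : nat) (s : seq 'rV[R]_n) : 'M[R]_(size s, n) :=
  \matrix_(r < size s) nth 0 s r.

Definition sphere (R : realType) (n : nat) : set 'rV[R]_n :=
  [set x | dotv x x = 1].

(* Main.v *)
Require Import Defs.
From HB Require Import structures.
From mathcomp Require Import all_boot all_order all_algebra.
From mathcomp Require Import all_classical all_reals all_analysis.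
From mathcomp Require Import ring lra zify.
Set Implicit Arguments. Unset Strict Implicit. Unset Printing Implicit Defensive.
Import Order.TTheory GRing.Theory Num.Theory numFieldNormedType.Exports.
Local Open Scope ring_scope.
Local Open Scope classical_set_scope.

(** Call E invariant under a subspace W if it is stable under the hyperplane
    reflections along all vectors of W, that is, if E contains with x every y with
    |y| = |x| and y - x in W. A nonempty subset of the sphere that is invariant
    under the whole space is the sphere.

    If a closed set E is invariant under W and W' and these share a nonzero
    vector, then E is invariant under W + W' (a maximisation argument on a compact
    set, instead of generating special orthogonal groups).

    The product of the reflections in M_1 and M_2 rotates the plane
    (e_{2j-1}, e_{2j}) by 2 alpha_j for all j simultaneously. By Kronecker's theorem
    and closedness, E is stable under all rotations of each single plane, hence
    invariant under it. With M_3 in place of M_2 one obtains the planes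
    (e_{2j-2}, e_{2j-1}). Chaining overlapping planes gives invariance under
    lin{e_1, ..., e_{2d}}, which contains M_1 + M_2 + M_3.

    If E is invariant under V and V' is the image of V under the reflection in M,
    then E is invariant under V', and V + V' = V + M when M meets V^perp trivially.
    Moreover V and V' share the vectors of V orthogonal to M, and there are nonzero
    ones as dim M = d < dim V. So M_4, ..., M_k can be added one at a time. *)

(** * Inner product and hyperplane reflections *)

Lemma dotvE (R : realType) n (x y : 'rV[R]_n) :
  dotv x y = \sum_i x 0 i * y 0 i.
Proof. by rewrite /dotv mxE; apply: eq_bigr => i _; rewrite mxE. Qed.

Lemma dotvC (R : realType) n (x y : 'rV[R]_n) : dotv x y = dotv y x.
Proof. by rewrite !dotvE; apply: eq_bigr => i _; rewrite mulrC. Qed.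

Lemma dotvDl (R : realType) n (x y z : 'rV[R]_n) :
  dotv (x + y) z = dotv x z + dotv y z.
Proof. by rewrite /dotv mulmxDl mxE. Qed.

Lemma dotvNl (R : realType) n (x z : 'rV[R]_n) : dotv (- x) z = - dotv x z.
Proof. by rewrite /dotv mulNmx mxE. Qed.

Lemma dotvZl (R : realType) n a (x z : 'rV[R]_n) :
  dotv (a *: x) z = a * dotv x z.
Proof. by rewrite /dotv -scalemxAl mxE. Qed.

Lemma dotv0l (R : realType) n (z : 'rV[R]_n) : dotv 0 z = 0.
Proof. by rewrite /dotv mul0mx mxE. Qed.

Lemma dotvDr (R : realType) n (x y z : 'rV[R]_n) :
  dotv z (x + y) = dotv z x + dotv z y.
Proof. by rewrite !(dotvC z) dotvDl. Qed.

Lemma dotvNr (R : realType) n (x z : 'rV[R]_n) : dotv z (- x) = - dotv z x.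
Proof. by rewrite !(dotvC z) dotvNl. Qed.

Lemma dotvZr (R : realType) n a (x z : 'rV[R]_n) :
  dotv z (a *: x) = a * dotv z x.
Proof. by rewrite !(dotvC z) dotvZl. Qed.

Lemma dotv0r (R : realType) n (z : 'rV[R]_n) : dotv z 0 = 0.
Proof. by rewrite dotvC dotv0l. Qed.

Lemma dotv_suml (R : realType) n I (r : seq I) (P : pred I)
    (F : I -> 'rV[R]_n) z :
  dotv (\sum_(j <- r | P j) F j) z = \sum_(j <- r | P j) dotv (F j) z.
Proof. exact: (big_morph (fun x => dotv x z) (fun x y => dotvDl x y z) (dotv0l z)). Qed.

Definition dotv_lin := (dotvDl, dotvDr, dotvNl, dotvNr, dotvZl, dotvZr).

Lemma dotv_ge0 (R : realType) n (x : 'rV[R]_n) : 0 <= dotv x x.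
Proof. by rewrite dotvE sumr_ge0 // => i _; rewrite -expr2 sqr_ge0. Qed.

Lemma dotv_eq0 (R : realType) n (x : 'rV[R]_n) : (dotv x x == 0) = (x == 0).
Proof.
apply/idP/eqP => [|->]; last by rewrite dotv0l.
rewrite dotvE psumr_eq0 => [/allP h|i _]; last by rewrite -expr2 sqr_ge0.
apply/rowP => i; have := h i (mem_index_enum i).
by rewrite /= -expr2 sqrf_eq0 mxE => /eqP.
Qed.

Lemma dotv_mulmx (R : realType) n m (x : 'rV[R]_n) (y : 'rV[R]_m) (A : 'M[R]_(n, m)) :
  dotv (x *m A) y = dotv x (y *m A^T).
Proof. by rewrite /dotv trmx_mul trmxK mulmxA. Qed.

Lemma dotv_row_eq0 (R : realType) n m (x : 'rV[R]_n) (A : 'M[R]_(m, n)) :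
  (forall v, (v <= A)%MS -> dotv x v = 0) -> x *m A^T = 0.
Proof.
move=> h; apply/rowP => i; rewrite [RHS]mxE.
rewrite -(h (row i A) (row_sub _ _)) dotvE mxE.
by apply: eq_bigr => j _; rewrite !mxE.
Qed.

Lemma dotv_sub_orth (R : realType) n m (x v : 'rV[R]_n) (A : 'M[R]_(m, n)) :
  x *m A^T = 0 -> (v <= A)%MS -> dotv x v = 0.
Proof.
by move=> h /submxP [c ->]; rewrite /dotv trmx_mul mulmxA h mul0mx mxE.
Qed.

Lemma continuous_sum (R : realType) (V : normedModType R)
    (T : topologicalType) I (r : seq I) (F : I -> T -> V) :
  (forall i, continuous (F i)) -> continuous (fun x => \sum_(i <- r) F i x).
Proof. by move=> h; apply: continuous_big => //; exact: add_continuous. Qed.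

Lemma continuous_dotv (R : realType) n (x : 'rV[R]_n) :
  continuous (fun y : 'rV[R]_n => dotv y x).
Proof.
rewrite (_ : (fun y : 'rV[R]_n => dotv y x) =
  fun y : 'rV[R]_n => \sum_i y 0 i * x 0 i); last first.
  by apply/funext => z; rewrite dotvE.
apply: continuous_sum => i y; apply: continuousM; last exact: cst_continuous.
exact: (@coord_continuous R 1 n 0 i y).
Qed.

Lemma continuous_dotvv (R : realType) n (x : 'rV[R]_n) :
  continuous (fun y : 'rV[R]_n => dotv (y - x) (y - x)).
Proof.
rewrite (_ : (fun y : 'rV[R]_n => dotv (y - x) (y - x)) =
  fun y : 'rV[R]_n => \sum_i (y 0 i - x 0 i) * (y 0 i - x 0 i)); last first.
  by apply/funext => z; rewrite dotvE; apply: eq_bigr => i _; rewrite !mxE.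
apply: continuous_sum => i y; have h : {for y, continuous (fun y : 'rV[R]_n => y 0 i - x 0 i)}.
  apply: continuousB; last exact: cst_continuous.
  exact: (@coord_continuous R 1 n 0 i y).
exact: (continuousM h h).
Qed.

Lemma continuous_mulmxr (R : realType) n m (A : 'M[R]_(n, m)) :
  continuous (fun y : 'rV[R]_n => y *m A).
Proof.
rewrite (_ : (fun y : 'rV[R]_n => y *m A) =
  fun y : 'rV[R]_n => \sum_i y 0 i *: row i A); last first.
  by apply/funext => z; rewrite mulmx_sum_row.
apply: continuous_sum => i y; apply: continuousZr_tmp.
exact: (@coord_continuous R 1 n 0 i y).
Qed.

(** For [v = 0] this is the identity, so invariance can quantify over all vectors of a subspace. *)
Definition hrefl (R : realType) n (v x : 'rV[R]_n) : 'rV[R]_n :=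
  x - (2 * dotv x v / dotv v v) *: v.

Lemma hreflD (R : realType) n (v x y : 'rV[R]_n) :
  hrefl v (x - y) = hrefl v x - hrefl v y.
Proof.
rewrite /hrefl !dotv_lin; apply/rowP => i; rewrite !mxE; ring.
Qed.

Lemma dotv_hrefl (R : realType) n (v x y : 'rV[R]_n) :
  dotv (hrefl v x) y = dotv x (hrefl v y).
Proof. rewrite /hrefl !dotv_lin (dotvC v y); ring. Qed.

Lemma hreflK (R : realType) n (v : 'rV[R]_n) : involutive (hrefl v).
Proof.
move=> x; have [->|v0] := eqVneq v 0; first by rewrite /hrefl !scaler0 !subr0.
have vv0 : dotv v v != 0 by rewrite dotv_eq0.
by rewrite /hrefl !dotv_lin; apply/rowP => i; rewrite !mxE; field.
Qed.

Lemma dotv_hrefl2 (R : realType) n (v x y : 'rV[R]_n) :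
  dotv (hrefl v x) (hrefl v y) = dotv x y.
Proof. by rewrite dotv_hrefl hreflK. Qed.

(** For points of equal norm, [y - x] is normal to the hyperplane through the origin that bisects
    them. *)
Lemma hrefl_swap (R : realType) n (x y : 'rV[R]_n) :
  dotv x x = dotv y y -> hrefl (y - x) x = y.
Proof.
move=> exy; have [->|yx] := eqVneq y x.
  by rewrite /hrefl subrr scaler0 subr0.
have vv0 : dotv (y - x) (y - x) != 0 by rewrite dotv_eq0 subr_eq0.
rewrite /hrefl (_ : _ / _ = -1); first by rewrite scaleN1r opprK addrC subrK.
apply: (mulIf vv0); rewrite divfK //.
rewrite !dotv_lin -exy (dotvC y x); ring.
Qed.

(** * Invariance under the reflections along a subspace *)

Lemma closed_rV_eq (R : realType) n m (A : 'M[R]_(n, m)) (b : 'rV[R]_m) :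
  closed [set z : 'rV[R]_n | z *m A = b].
Proof.
apply: (@preimage_closed _ _ (fun z : 'rV[R]_n => z *m A) [set b]).
  by move=> z _; exact: continuous_mulmxr.
by apply: accessible_closed_set1; apply: hausdorff_accessible; exact: norm_hausdorff.
Qed.

Lemma closed_dotvv (R : realType) n (a : 'rV[R]_n) (r : R) :
  closed [set z : 'rV[R]_n | r <= dotv (z - a) (z - a)] /\
  closed [set z : 'rV[R]_n | dotv (z - a) (z - a) = r].
Proof.
split.
  apply: (@preimage_closed _ _ (fun z : 'rV[R]_n => dotv (z - a) (z - a)) [set t | r <= t]).
    by move=> z _; exact: continuous_dotvv.
  exact: closed_ge.
apply: (@preimage_closed _ _ (fun z : 'rV[R]_n => dotv (z - a) (z - a)) [set t | t = r]).
  by move=> z _; exact: continuous_dotvv.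
exact: closed_eq.
Qed.

Lemma rV_norm_le (R : realType) n (z : 'rV[R]_n) (r : R) : 0 <= r ->
  (forall i, `|z 0 i| <= r) -> `|z| <= r.
Proof.
move=> r0 h; rewrite [`|z|]mx_normrE; apply/bigmax_leP; split=> // -[i j] _ /=.
by rewrite ord1.
Qed.

Lemma coord_le_dotv (R : realType) n (z : 'rV[R]_n) i :
  `|z 0 i| <= dotv z z + 1.
Proof.
have h : z 0 i ^+ 2 <= dotv z z.
  rewrite dotvE (bigD1 i) //= -expr2 lerDl sumr_ge0 // => j _.
  by rewrite -expr2 sqr_ge0.
have := real_normK (num_real (z 0 i)); have := normr_ge0 (z 0 i).
move: h; set t := `|_|; move: (z 0 i ^+ 2) => s; nra.
Qed.

Lemma dotv_bounded (R : realType) n (r : R) :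
  bounded_set [set z : 'rV[R]_n | dotv z z = r].
Proof.
exists (r + 1); split; first exact: num_real.
move=> M rM z /= zr; apply: rV_norm_le.
  apply: le_trans (ltW rM); rewrite -zr; have := dotv_ge0 z; lra.
by move=> i; apply: le_trans (ltW rM); rewrite -zr; exact: coord_le_dotv.
Qed.

Definition hrefl_inv (R : realType) n m (E : set 'rV[R]_n) (W : 'M[R]_(m, n)) :=
  forall v, (v <= W)%MS -> forall x, E x -> E (hrefl v x).

Lemma hrefl_inv_sub (R : realType) n m m' (E : set 'rV[R]_n)
    (W : 'M[R]_(m, n)) (W' : 'M[R]_(m', n)) :
  (W' <= W)%MS -> hrefl_inv E W -> hrefl_inv E W'.
Proof. by move=> sW EW v vW'; apply: EW; exact: submx_trans vW' sW. Qed.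

(* z maximises the inner product with u over the points of E that differ from x by
   a vector of W + W' and have the same norm; comparing z with its reflections in
   W and in W' shows that z - c u is orthogonal to W + W'. *)
Lemma hrefl_inv_argmax (R : realType) n m m' (E : set 'rV[R]_n)
    (W : 'M[R]_(m, n)) (W' : 'M[R]_(m', n)) (u x : 'rV[R]_n) :
  closed E -> hrefl_inv E W -> hrefl_inv E W' ->
  u != 0 -> (u <= W)%MS -> (u <= W')%MS -> E x ->
  exists z c, [/\ E z, (z - x <= W + W')%MS, dotv z z = dotv x x, 0 <= c &
    forall v, (v <= W + W')%MS -> dotv z v = c * dotv u v].
Proof.
move=> Ecl EW EW' u0 uW uW' Ex.
(* Multiplying by [cokermx] turns membership of [z - x] in [W + W'] into a linear equation, hence a
   closed condition. *)
pose K := E `&` ([set z : 'rV[R]_n | z *m cokermx (W + W')%MS = x *m cokermx (W + W')%MS]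
  `&` [set z : 'rV[R]_n | dotv (z - 0) (z - 0) = dotv x x]).
have KE z : K z <-> [/\ E z, (z - x <= W + W')%MS & dotv z z = dotv x x].
  rewrite /K /= !subr0 submxE mulmxBl subr_eq0; split; first by move=> [? [-> ->]].
  by move=> [? /eqP -> ->].
have Kcompact : compact K.
  apply: bounded_closed_compact.
    have [M [Mr MK]] := dotv_bounded n (dotv x x).
    by exists M; split=> // M' /MK h z /KE [_ _]; exact: h.
  apply: closedI => //; apply: closedI; first exact: closed_rV_eq.
  by case: (closed_dotvv (0 : 'rV[R]_n) (dotv x x)).
have K0 : K !=set0 by exists x; apply/KE; rewrite subrr sub0mx.
have uK : {within K, continuous (fun z => dotv z u)}.
  by apply: continuous_subspaceT => z; exact: continuous_dotv.
have [z] := EVT_max_rV K0 Kcompact uK.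
rewrite inE => /KE [Ez zx zz] zmax.
have uu : 0 < dotv u u by rewrite lt_def dotv_eq0 u0 dotv_ge0.
(* Reflecting [z] along [v] changes its inner product with [u] by a negative multiple of
   [dotv z v * dotv u v], and maximality forbids an increase. *)
have key v : (forall x, E x -> E (hrefl v x)) -> (v <= W + W')%MS ->
    0 <= dotv z v * dotv u v.
  move=> Ev vV; have [->|v0] := eqVneq v 0; first by rewrite dotv0r mul0r.
  have vv : 0 < dotv v v by rewrite lt_def dotv_eq0 v0 dotv_ge0.
  have : hrefl v z \in K.
    rewrite inE KE dotv_hrefl2; split=> //; first exact: Ev.
    by rewrite /hrefl addrAC addmx_sub // eqmx_opp scalemx_sub.
  move/zmax.
  rewrite /hrefl !dotv_lin gerDl oppr_le0 (dotvC v u) => h.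
  rewrite -(@pmulr_rge0 _ (2 / dotv v v)) ?divr_gt0 //.
  by apply: le_trans h _; rewrite le_eqVlt; apply/orP; left; apply/eqP; ring.
have uV : (u <= W + W')%MS by exact: submx_trans uW (addsmxSl _ _).
have a0 : 0 <= dotv z u by have := key u (EW u uW) uV; rewrite pmulr_lge0.
pose c := dotv z u / dotv u u; have c0 : 0 <= c by rewrite divr_ge0 // ltW.
(* With b := dotv z w - c * dotv u w, the inequality [key] for w + t u reads
   (b + s c) s >= 0, where s := dotv u (w + t u) is arbitrary; this forces b = 0. *)
have step w : (forall t x, E x -> E (hrefl (w + t *: u) x)) -> (w <= W + W')%MS ->
    dotv z w = c * dotv u w.
  move=> Ew wV.
  pose b := dotv z w - c * dotv u w.
  (* This [s] solves [b + s * c = - s], so the inequality becomes [- s ^+ 2 >= 0]; [t] is then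
     chosen to give [dotv u (w + t *: u) = s]. *)
  pose s := - b / (c + 1); pose t := (s - dotv u w) / dotv u u.
  have := key (w + t *: u) (Ew t).
  rewrite addmx_sub // ?scalemx_sub // => /(_ isT).
  have -> : dotv u (w + t *: u) = s.
    by rewrite !dotv_lin /t divfK ?gt_eqF // addrC subrK.
  have -> : dotv z (w + t *: u) = b + s * c.
    by rewrite !dotv_lin /t /b /c; field; rewrite gt_eqF.
  have c1 : c + 1 != 0 by rewrite gt_eqF // ltr_wpDl.
  have -> : (b + s * c) * s = - s ^+ 2.
    by rewrite /s; field.
  rewrite oppr_ge0 => s2; have : s ^+ 2 == 0 by rewrite eq_le s2 sqr_ge0.
  rewrite sqrf_eq0 /s mulf_eq0 invr_eq0 (negPf c1) orbF oppr_eq0 subr_eq0.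
  by move/eqP.
exists z, c; split=> // v /sub_addsmxP [[p q] /= ->].
rewrite !dotv_lin !(step (_ *m _)) ?mulrDr //.
- by move=> t; apply: EW'; rewrite addmx_sub // ?submxMl // scalemx_sub.
- by apply: submx_trans (addsmxSr _ _); exact: submxMl.
- by move=> t; apply: EW; rewrite addmx_sub // ?submxMl // scalemx_sub.
- by apply: submx_trans (addsmxSl _ _); exact: submxMl.
Qed.

(** Balls refer to the maximum norm, which is at most the Euclidean one. Halving the radius of a
    ball around [y] that avoids [E] restores the strict inequality. *)
Lemma closed_dotv_sep (R : realType) n (E : set 'rV[R]_n) (y : 'rV[R]_n) :
  closed E -> ~ E y -> exists2 r : R, 0 < r & forall a, E a -> r <= dotv (a - y) (a - y).
Proof.
move=> Ecl Ey; have : open (~` E) by exact: closed_openC.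
rewrite openE => /(_ y Ey) /nbhs_ballP [r /= r0 hr].
exists ((r / 2) ^+ 2) => [|a Ea]; first by rewrite exprn_gt0 // divr_gt0.
rewrite leNgt; apply/negP => lt_r; apply: (hr a) => //.
rewrite -ball_normE /ball_ /= -normrN opprB; apply: (@le_lt_trans _ _ (r / 2)); last by lra.
apply: rV_norm_le => [|i]; first by rewrite divr_ge0 // ltW.
have r2 : 0 <= r / 2 by rewrite divr_ge0 // ltW.
rewrite -(@ler_pXn2r _ 2) ?nnegrE // real_normK ?num_real //.
apply: le_trans _ (ltW lt_r); rewrite dotvE (bigD1 i) //= -expr2 lerDl.
by rewrite sumr_ge0 // => j _; rewrite -expr2 sqr_ge0.
Qed.

(* If y = hrefl v x were not in E, it would lie in the closed set F of the points
   at distance at least sqrt r from E, which has the same invariance as E. The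
   maximisers of [hrefl_inv_argmax] reached from x in E and from y in F coincide. *)
Lemma hrefl_inv_adds (R : realType) n m m' (E : set 'rV[R]_n)
    (W : 'M[R]_(m, n)) (W' : 'M[R]_(m', n)) (u : 'rV[R]_n) :
  closed E -> hrefl_inv E W -> hrefl_inv E W' ->
  u != 0 -> (u <= W)%MS -> (u <= W')%MS -> hrefl_inv E (W + W')%MS.
Proof.
move=> Ecl EW EW' u0 uW uW' v vV x Ex; set y := hrefl v x.
apply: contrapT => Ey; have [r r0 rE] := closed_dotv_sep Ecl Ey.
pose F := \bigcap_(a in E) [set b | r <= dotv (b - a) (b - a)].
have Fcl : closed F.
  by apply: closed_bigI => a _; case: (closed_dotvv a r).
(* Reflections are isometric involutions, so moving [b] is the same as moving the points of [E]. *)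
have inv_F k (U : 'M[R]_(k, n)) : hrefl_inv E U -> hrefl_inv F U.
  move=> EU w wU b Fb a Ea /=.
  rewrite -(hreflK w a) -hreflD dotv_hrefl2; exact: (Fb _ (EU w wU a Ea)).
have Fy : F y by move=> a Ea /=; rewrite -opprB dotvNl dotvNr opprK rE.
have [z [c [Ez zx zz c0 zV]]] := hrefl_inv_argmax Ecl EW EW' u0 uW uW' Ex.
have [z' [c' [Fz' zy zz' c'0 zV']]] :=
  hrefl_inv_argmax Fcl (inv_F _ _ EW) (inv_F _ _ EW') u0 uW uW' Fy.
have xyV : (x - y <= W + W')%MS.
  by rewrite /y /hrefl opprB addrC addrNK scalemx_sub.
have uV : (u <= W + W')%MS by exact: submx_trans uW (addsmxSl _ _).
have zzV : (z - z' <= W + W')%MS.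
  have -> : z - z' = (z - x) + (x - y) - (z' - y).
    by apply/rowP => i; rewrite !mxE; ring.
  by apply: addmx_sub; [exact: addmx_sub|rewrite eqmx_opp].
(* This vector lies in [W + W'] and is also orthogonal to it, so it vanishes. *)
have [w wE] : exists w, w = z - z' - (c - c') *: u by exists (z - z' - (c - c') *: u).
have /eqP : dotv w w == 0.
  have wV : (w <= W + W')%MS by rewrite wE; apply: addmx_sub; rewrite // eqmx_opp scalemx_sub.
  rewrite {1}wE !dotv_lin (zV w) // (zV' w) //; apply/eqP; ring.
move/eqP; rewrite dotv_eq0 wE subr_eq0 => /eqP dz.
have dzz : dotv z z = dotv z' z' by rewrite zz zz' dotv_hrefl2.
(* As [z] and [z'] have equal norms, [(c - c') * (c + c') * dotv u u = 0] with [c] and [c']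
   non-negative. Then [z = z'] lies in both [E] and [F], which is absurd. *)
have cc : c = c'.
  have z'E : z = z' + (c - c') *: u by rewrite -dz addrC subrK.
  have uu : dotv u u != 0 by rewrite dotv_eq0.
  have : (c - c') * (c + c') * dotv u u = 0.
    have s := zV' u uV; have : dotv z z - dotv z' z' = 0 by rewrite dzz subrr.
    rewrite z'E !dotv_lin (dotvC u z') s => h; rewrite -[RHS]h; ring.
  move/eqP; rewrite !mulf_eq0 (negPf uu) orbF => /orP [|].
    by rewrite subr_eq0 => /eqP.
  by rewrite paddr_eq0 // => /andP [/eqP -> /eqP ->].
have := Fz' z Ez; rewrite /= -opprB dz cc subrr scale0r oppr0 dotv0l leNgt r0.
by [].
Qed.

Lemma hrefl_inv_sphere (R : realType) n (E : set 'rV[R]_n) :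
  E !=set0 -> E `<=` @sphere R n -> hrefl_inv E 1%:M -> E = @sphere R n.
Proof.
move=> [x Ex] Es EW; apply/seteqP; split=> // y ys.
have xs := Es x Ex; rewrite -(@hrefl_swap _ _ x y); first by apply: EW; rewrite ?submx1.
by rewrite xs ys.
Qed.

(** Conjugating the reflection along [w] by an orthogonal [Q] gives the reflection along
    [w *m Q]. *)
Lemma hrefl_inv_mulmx (R : realType) n m (E : set 'rV[R]_n)
    (W : 'M[R]_(m, n)) (Q : 'M[R]_n) :
  Q *m Q^T = 1%:M -> (forall x, E x <-> E (x *m Q)) ->
  hrefl_inv E W -> hrefl_inv E (W *m Q).
Proof.
move=> QQ EQ EW v /submxP [c ->] x Ex; rewrite mulmxA.
have QQ' : Q^T *m Q = 1%:M by exact: mulmx1C.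
have xE : x = x *m Q^T *m Q by rewrite -mulmxA QQ' mulmx1.
have : E (hrefl (c *m W) (x *m Q^T)) by apply: EW; rewrite ?submxMl // EQ -xE.
move/EQ; congr (E _); rewrite /hrefl mulmxBl -xE -scalemxAl.
by rewrite !dotv_mulmx trmxK -[_ *m Q *m _]mulmxA QQ mulmx1.
Qed.

(** * Kronecker's theorem *)

Lemma bounded_seq_cluster (R : realType) r (w : nat -> 'rV[R]_r) (M : R) :
  (forall m, `|w m| <= M) ->
  exists u, forall eps, 0 < eps -> forall N, exists2 m, (N <= m)%N & `|u - w m| < eps.
Proof.
move=> wM; pose K := [set z : 'rV[R]_r | `|z| <= M].
have Kcompact : compact K.
  apply: bounded_closed_compact.
    by exists M; split=> [|M' MM' z zM]; [exact: num_real | exact: le_trans zM (ltW MM')].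
  apply: (@preimage_closed _ _ (fun z : 'rV[R]_r => `|z|) [set t | t <= M]); last exact: closed_le.
  by move=> z _; exact: norm_continuous.
have wK : \forall m \near \oo, K (w m) by apply: nearW => m; exact: wM.
have [u [_ wu]] := Kcompact (w @ \oo) _ wK.
exists u => eps eps0 N.
have [_ [[m Nm <-]]] : [set w m | m in [set m | (N <= m)%N]] `&` ball u eps !=set0.
  apply: wu; last exact: nbhsx_ballx.
  by exists N => [//|m Nm]; exists m.
rewrite -ball_normE => h; exists m => //.
Qed.

Section ClosedSubgroup.
Variables (R : realType) (r : nat) (S : set 'rV[R]_r).
Hypotheses (Sclosed : closed S) (S0 : S 0).
Hypothesis SB : forall x y, S x -> S y -> S (x - y).

Lemma subgroupD x y : S x -> S y -> S (x + y).
Proof. by move=> Sx Sy; rewrite -[y]opprK -[- y]sub0r; apply: SB => //; exact: SB. Qed.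

Lemma subgroup_intmul (k : int) x : S x -> S (k%:~R *: x).
Proof.
move=> Sx; have nat_case (m : nat) : S (m%:R *: x).
  elim: m => [|m ih]; first by rewrite scale0r.
  by rewrite -natr1 scalerDl scale1r; exact: subgroupD.
case: k => m; first exact: nat_case.
by rewrite NegzE mulrNz scaleNr -sub0r; apply: SB => //; exact: nat_case.
Qed.

Lemma subgroup_sum I (s : seq I) (P : pred I) (F : I -> 'rV[R]_r) :
  (forall i, P i -> S (F i)) -> S (\sum_(i <- s | P i) F i).
Proof. by move=> SF; apply: big_ind => //; exact: subgroupD. Qed.

(** Normalised short elements of [S] accumulate at a direction [u]. Integer multiples of such a
    short element come within its own length of any point of its line, so they approximate every
    [t *: u]. *)
Lemma nondiscrete_subgroup_line :
  (forall eps, 0 < eps -> exists v, [/\ S v, v != 0 & `|v| < eps]) ->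
  exists2 u, u != 0 & forall t, S (t *: u).
Proof.
move=> small.
have /choice [v vP] m : exists v, [/\ S v, v != 0 & `|v| < m.+1%:R^-1].
  by apply: small; rewrite invr_gt0.
pose w m := `|v m|^-1 *: v m.
have v0 m : `|v m| != 0 by rewrite normr_eq0; case: (vP m).
have w1 m : `|w m| = 1 by rewrite normrZ normfV normr_id mulVf.
have [|u wu] := @bounded_seq_cluster R r w 1; first by move=> m; rewrite w1.
exists u => [|t].
  have [|m _] := wu 1 _ 0%N => //.
  by apply: contraTneq => ->; rewrite sub0r normrN w1 ltxx.
apply: contrapT => nS.
have : open (~` S) by exact: closed_openC.
rewrite openE => /(_ _ nS) /nbhs_ballP [rho /= rho0 hrho].
have [N _ hN] := near_infty_natSinv_lt (PosNum (divr_gt0 rho0 (ltr0n _ 2))).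
(* This tolerance keeps [t *: (u - w m)] within [rho / 2]; the added 1 covers [t = 0]. *)
have [|m Nm um] := wu (rho / 2 / (`|t| + 1)) _ N.
  by rewrite !divr_gt0 // ltr_wpDl.
have [Sv _ vm] := vP m.
pose k := Num.floor (t / `|v m|).
apply: (hrho (k%:~R *: v m)); last exact: subgroup_intmul.
rewrite -ball_normE /ball_ /=.
have -> : t *: u - k%:~R *: v m = t *: (u - w m) + (t / `|v m| - k%:~R) *: v m.
  by rewrite /w; apply/rowP => i; rewrite !mxE; field.
apply: le_lt_trans (ler_normD _ _) _; rewrite !normrZ.
have h1 : `|t / `|v m| - k%:~R| <= 1.
  have /andP [lo hi] := floor_itv (t / `|v m|).
  rewrite ger0_norm ?subr_ge0 //; move: hi; rewrite intrD; rewrite -/k; lra.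
have h2 : `|t| * `|u - w m| <= rho / 2.
  move: um; rewrite ltr_pdivlMr ?ltr_wpDl // => um.
  have := normr_ge0 (u - w m); nra.
have h3 : `|v m| < rho / 2 by apply: lt_trans vm (hN m Nm).
have := normr_ge0 (v m); have := normr_ge0 (t / `|v m| - k%:~R); nra.
Qed.

(* The fractional parts of the multiples m c lie in S and in the unit cube: either
   two of them are equal, or they accumulate and S contains a line. *)
Lemma discrete_subgroup_rational (c : 'rV[R]_r) :
  (forall j, S (delta_mx 0 j)) ->
  (forall u, (forall t, S (t *: u)) -> u = 0) ->
  S c -> forall j, exists q : rat, c 0 j = ratr q.
Proof.
move=> Sdelta noline Sc.
pose fl m : 'rV[R]_r := \row_j (Num.floor (m%:R * c 0 j))%:~R.
pose s m := m%:R *: c - fl m.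
have Ss m : S (s m).
  apply: SB; first exact: (subgroup_intmul m).
  rewrite [fl m]row_sum_delta; apply: subgroup_sum => j _.
  by rewrite mxE; exact: subgroup_intmul.
have s1 m : `|s m| <= 1.
  apply: rV_norm_le => // j; rewrite !mxE.
  have /andP [lo hi] := floor_itv (m%:R * c 0 j).
  rewrite ger0_norm ?subr_ge0 //; move: hi; rewrite intrD; lra.
have [[m [m' [lt_mm' smm']]]|inj] := pselect (exists m m', (m < m')%N /\ s m = s m').
  move=> j; have := congr1 (fun z : 'rV[R]_r => z 0 j) smm'; rewrite !mxE.
  set z := Num.floor _; set z' := Num.floor _ => h.
  exists ((z' - z)%:~R / (m' - m)%:R).
  have mm0 : (m' - m)%:R != 0 :> R by rewrite pnatr_eq0 -lt0n subn_gt0.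
  rewrite fmorph_div rmorph_int rmorph_nat; apply: (mulIf mm0).
  by rewrite divfK // natrB ?(ltnW lt_mm') // intrB; lra.
have [p sp] := bounded_seq_cluster s1.
exfalso; have [eps eps0|u u0 Su] := nondiscrete_subgroup_line; last first.
  by move/eqP: u0; apply; exact: noline.
have eps2 : 0 < eps / 2 by rewrite divr_gt0.
have [m _ mp] := sp _ eps2 0%N; have [m' lt_mm' m'p] := sp _ eps2 m.+1.
exists (s m - s m'); split; first exact: SB.
  by rewrite subr_eq0; apply/eqP => e; apply: inj; exists m, m'.
have -> : s m - s m' = (p - s m') - (p - s m) by apply/rowP => i; rewrite !mxE; ring.
apply: le_lt_trans (ler_normB _ _) _; lra.
Qed.

End ClosedSubgroup.

(* Let V be a linear subspace of maximal rank inside S. Modulo V the subgroup S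
   contains no line and a basis B taken among the images of the unit vectors, so
   all its elements have rational coordinates in B; for b this is a rational
   relation between 1 and the coordinates of b. *)
Lemma kronecker (R : realType) d (S : set 'rV[R]_d) (b : 'rV[R]_d) :
  closed S -> (forall x y, S x -> S y -> S (x - y)) ->
  (forall j, S (delta_mx 0 j)) -> S b ->
  (forall (q0 : rat) (q : 'I_d -> rat),
     ratr q0 + \sum_j ratr (q j) * b 0 j = 0 -> forall j, q j = 0) ->
  forall x, S x.
Proof.
move=> Scl SB Sdelta Sb indep.
have S0 : S 0 by rewrite -(subrr b); exact: SB.
have SD := subgroupD S0 SB.
pose P k := exists2 V : 'M[R]_d, \rank V = k & forall v : 'rV_d, (v <= V)%MS -> S v.
have P0 : exists k, `[<P k>].
  exists 0%N; apply/asboolP; exists 0; first exact: mxrank0.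
  by move=> v; rewrite submx0 => /eqP ->.
have Pd k : `[<P k>] -> (k <= d)%N by move=> /asboolP [V <- _]; exact: rank_leq_col.
case: (ex_maxnP P0 Pd) => _ /asboolP [V <- SV] Vmax.
pose Pi := proj_mx V^C%MS V.
have capC : (V^C :&: V)%MS = 0 by apply/eqP; rewrite -submx0 capmxC capmx_compl.
have full (x : 'rV_d) : (x <= V^C + V)%MS.
  by rewrite addsmxC; apply: submx_full; exact: addsmx_compl_full.
have PiV (x : 'rV[R]_d) : (x - x *m Pi <= V)%MS by apply: proj_mx_compl_sub; exact: full.
have SPi x : S x -> S (x *m Pi).
  by move=> Sx; rewrite -[_ *m _](subKr x); apply: SB => //; exact: SV.
(* The basis is selected among the rows of [Pi], the projected unit vectors, so that it lies in
   [S]. *)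
pose f := maxrankfun Pi; pose B := rowsub f Pi.
have Bfree : row_free B := maxrowsub_free Pi.
have PiB : (Pi <= B)%MS by rewrite eq_maxrowsub.
have BC : (B <= V^C)%MS.
  rewrite eq_maxrowsub; rewrite -[Pi]mul1mx; exact: proj_mx_sub.
pose S' := [set c : 'rV[R]_(\rank Pi) | S (c *m B)].
have S'cl : closed S'.
  apply: (@preimage_closed _ _ (fun z : 'rV[R]_(\rank Pi) => z *m B) S) => // z _.
  exact: continuous_mulmxr.
have S'0 : S' 0 by rewrite /S' /= mul0mx.
have S'B x y : S' x -> S' y -> S' (x - y) by rewrite /S' /= mulmxBl; exact: SB.
have rowB j : row j B = delta_mx 0 (f j) *m Pi by rewrite -rowE; apply/rowP => l; rewrite !mxE.
have S'delta j : S' (delta_mx 0 j).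
  by rewrite /S' /= -rowE rowB; apply: SPi.
(* A line in [S'] would enlarge [V] to a subspace of [S] of larger rank. *)
have noline u : (forall t, S' (t *: u)) -> u = 0.
  move=> Su; apply: contrapT => /eqP u0.
  have uB0 : u *m B != 0.
    by rewrite -(mul0mx _ B); apply: contra_neq u0; exact: row_free_inj.
  have uBC : (u *m B <= V^C)%MS by apply: submx_trans BC; exact: submxMl.
  have uBV : ~~ (u *m B <= V)%MS.
    by apply: contra uB0 => uBV; rewrite -submx0 -capC sub_capmx uBC.
  have : (\rank V < \rank (V + u *m B)%MS)%N.
    apply: rank_ltmx; rewrite /ltmx addsmxSl /=.
    by apply: contra uBV; apply: submx_trans; exact: addsmxSr.
  rewrite ltnNge Vmax //; apply/asboolP; exists (V + u *m B)%MS => // v.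
  case/sub_addsmxP => -[p q] /= ->; apply: SD; first by apply: SV; exact: submxMl.
  by rewrite [q]mx11_scalar mul_scalar_mx scalemxAl; exact: Su.
have rational c : S' c -> forall j, exists q : rat, c 0 j = ratr q.
  exact: discrete_subgroup_rational.
case: (posnP (\rank Pi)) => [/eqP|r0].
  rewrite mxrank_eq0 => /eqP Pi0 x; apply: SV.
  by have := PiV x; rewrite Pi0 mulmx0 subr0.
pose j0 := Ordinal r0.
have /choice [c cE] l : exists c : 'rV_(\rank Pi), row l Pi = c *m B.
  by apply/submxP; apply: submx_trans PiB; exact: row_sub.
have S'c l : S' (c l) by rewrite /S' /= -cE rowE; exact: SPi.
have S'b : S' (\sum_l b 0 l *: c l).
  rewrite /S' /= mulmx_suml (_ : \sum_l _ = b *m Pi); first exact: SPi.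
  by rewrite [RHS]mulmx_sum_row; apply: eq_bigr => l _; rewrite cE scalemxAl.
have [q0 q0E] := rational _ S'b j0.
have /choice [q qE] l : exists q : rat, c l 0 j0 = ratr q by exact: rational.
(* Row [f j0] of [Pi] is basis vector [j0] itself, with coordinate 1 there; the rational relation
   for [b] forces this coordinate to be 0. *)
have cf : c (f j0) = delta_mx 0 j0.
  apply: (row_free_inj Bfree); rewrite -cE -rowE rowB -rowE //.
have q0' : q (f j0) = 0.
  apply: (indep (- q0)); rewrite rmorphN /= -q0E summxE addrC.
  by apply/eqP; rewrite subr_eq0; apply/eqP/eq_bigr => l _; rewrite mxE -qE mulrC.
have := qE (f j0); rewrite q0' cf mxE !eqxx rmorph0 /= => /eqP.
by rewrite oner_eq0.
Qed.

(** * Reflections in subspaces and simultaneous plane rotations *)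

(** If [v] is killed by the Gram matrix, then [v *m B] has norm 0, and the rows of [B] are
    independent. *)
Lemma gram_unitmx (R : realType) n m (B : 'M[R]_(m, n)) :
  row_free B -> B *m B^T \in unitmx.
Proof.
move=> Bfree; rewrite -row_free_unit -kermx_eq0; apply/rowV0P => v.
move/sub_kermxP; rewrite mulmxA => vB.
have : dotv (v *m B) (v *m B) == 0 by rewrite /dotv trmx_mul mulmxA vB mul0mx mxE.
by rewrite dotv_eq0 -(mul0mx _ B) => /eqP /(row_free_inj Bfree).
Qed.

Definition projmx (R : realType) n m (H : 'M[R]_(m, n)) : 'M[R]_n :=
  let B := row_base H in B^T *m invmx (B *m B^T) *m B.

Lemma tr_projmx (R : realType) n m (H : 'M[R]_(m, n)) : (projmx H)^T = projmx H.
Proof.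
rewrite /projmx /=; move: (row_base H) => B.
by rewrite !trmx_mul trmx_inv trmx_mul !trmxK mulmxA.
Qed.

Lemma projmx_idem (R : realType) n m (H : 'M[R]_(m, n)) :
  projmx H *m projmx H = projmx H.
Proof.
rewrite /projmx; set B := row_base H; set G := B *m B^T.
have GU : G \in unitmx by apply: gram_unitmx; exact: row_base_free.
transitivity (B^T *m invmx G *m G *m invmx G *m B); first by rewrite /G !mulmxA.
by rewrite mulmxKV.
Qed.

Lemma projv_sub (R : realType) n m (H : 'M[R]_(m, n)) (x : 'rV[R]_n) :
  (Defs.projv H x <= H)%MS.
Proof. by rewrite /Defs.projv mulmxA (submx_trans (submxMl _ _)) // eq_row_base. Qed.

Lemma projv_orth (R : realType) n m (H : 'M[R]_(m, n)) (x : 'rV[R]_n) :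
  (x - Defs.projv H x) *m H^T = 0.
Proof.
have /submxP [c cE] : (H <= row_base H)%MS by rewrite eq_row_base.
have := row_base_free H; rewrite [in H^T]cE /Defs.projv /=.
move: (row_base H) => B Bfree.
rewrite trmx_mul mulmxA (_ : _ *m B^T = 0) ?mul0mx //.
by rewrite mulmxBl -!mulmxA mulVmx ?gram_unitmx // mulmx1 subrr.
Qed.

Lemma projv_uniq (R : realType) n m (H : 'M[R]_(m, n)) (x y : 'rV[R]_n) :
  (y <= H)%MS -> (x - y) *m H^T = 0 -> Defs.projv H x = y.
Proof.
move=> yH xyH; apply/eqP; rewrite -subr_eq0 -dotv_eq0; apply/eqP.
have pyH : (Defs.projv H x - y <= H)%MS by rewrite addmx_sub ?projv_sub // eqmx_opp.
apply: dotv_sub_orth pyH.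
have -> : Defs.projv H x - y = (x - y) - (x - Defs.projv H x).
  by apply/rowP => i; rewrite !mxE; ring.
by rewrite mulmxBl xyH projv_orth subrr.
Qed.

(** The two choices of the subspaces [M j] thus differ only by a sign, carried below as a factor
    [eps] with [eps ^+ 2 = 1]. *)
Lemma reflv_orthc (R : realType) n m (H : 'M[R]_(m, n)) (x : 'rV[R]_n) :
  reflv (orthc H) x = - reflv H x.
Proof.
rewrite /reflv (@projv_uniq _ _ _ (orthc H) x (x - Defs.projv H x)).
- by apply/rowP => i; rewrite !mxE; ring.
- by rewrite /orthc; apply/sub_kermxP; exact: projv_orth.
have /submxP [c cE] := projv_sub H x.
rewrite subKr cE -mulmxA (_ : H *m _ = 0) ?mulmx0 //.
by apply: trmx_inj; rewrite trmx_mul trmxK /orthc mulmx_ker trmx0.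
Qed.

Definition reflmx (R : realType) n m (H : 'M[R]_(m, n)) : 'M[R]_n :=
  projmx H *+ 2 - 1%:M.

Lemma reflvE (R : realType) n m (H : 'M[R]_(m, n)) (x : 'rV[R]_n) :
  reflv H x = x *m reflmx H.
Proof. by rewrite /reflv /reflmx mulmxBr mulmx1 !mulr2n mulmxDr. Qed.

Lemma tr_reflmx (R : realType) n m (H : 'M[R]_(m, n)) : (reflmx H)^T = reflmx H.
Proof. by rewrite /reflmx linearB /= linearMn /= tr_projmx trmx1. Qed.

Lemma reflmxK (R : realType) n m (H : 'M[R]_(m, n)) : reflmx H *m reflmx H = 1%:M.
Proof.
rewrite /reflmx mulmxBr mulmx1 mulmxBl mul1mx !mulr2n mulmxDr !mulmxDl projmx_idem.
by apply/matrixP => i j; rewrite !mxE; ring.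
Qed.

Lemma sub_lin (R : realType) n (s : seq 'rV[R]_n) x : x \in s -> (x <= lin s)%MS.
Proof.
move=> xs; have lt_i : (index x s < size s)%N by rewrite index_mem.
by rewrite -(nth_index 0 xs); apply: (eq_row_sub (Ordinal lt_i)); apply/rowP => j; rewrite !mxE.
Qed.

Lemma lin_sub (R : realType) n m (s : seq 'rV[R]_n) (A : 'M[R]_(m, n)) :
  {in s, forall x, (x <= A)%MS} -> (lin s <= A)%MS.
Proof.
by move=> h; apply/row_subP => i; rewrite rowK; apply: h; exact: mem_nth.
Qed.

Lemma lin_orth (R : realType) n (s : seq 'rV[R]_n) (w : 'rV[R]_n) :
  {in s, forall u, dotv w u = 0} -> w *m (lin s)^T = 0.
Proof.
move=> h; apply/rowP => i; rewrite [RHS]mxE -(h _ (mem_nth 0 (ltn_ord i))) dotvE mxE.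
by apply: eq_bigr => j _; rewrite !mxE.
Qed.

(** Families are numbered from 1 and ordinals from 0, hence the successors. *)
Lemma reflv_orthonormal (R : realType) n m d (u : nat -> 'rV[R]_n) (A : 'M[R]_(m, n)) x :
  (forall i j : 'I_d, dotv (u i.+1) (u j.+1) = (i == j)%:R) ->
  (A == lin [seq u j | j <- iota 1 d])%MS ->
  reflv A x = (\sum_(j < d) dotv x (u j.+1) *: u j.+1) *+ 2 - x.
Proof.
move=> ou /andP [Alin linA]; rewrite /reflv.
rewrite (@projv_uniq _ _ _ _ _ (\sum_(j < d) dotv x (u j.+1) *: u j.+1)) //.
  apply: summx_sub => j _; apply: scalemx_sub; apply: submx_trans linA.
  by apply: sub_lin; apply: map_f; rewrite mem_iota; have := ltn_ord j; lia.
apply: dotv_row_eq0 => v vA; apply: dotv_sub_orth (submx_trans vA Alin).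
apply: lin_orth => y /mapP [l]; rewrite mem_iota => ld ->.
have [j ->] : exists j : 'I_d, l = j.+1.
  have ltl : (l.-1 < d)%N by lia.
  by exists (Ordinal ltl) => /=; lia.
rewrite dotvDl dotvNl dotv_suml (bigD1 j) //= dotvZl ou eqxx mulr1.
by rewrite big1 ?addr0 ?subrr // => i /negPf ne; rewrite dotvZl ou ne mulr0.
Qed.

Section TorusAction.
Variables (R : realType) (n d : nat) (a b : nat -> 'rV[R]_n).
Hypothesis oa : forall i j : 'I_d, dotv (a i.+1) (a j.+1) = (i == j)%:R.
Hypothesis ob : forall i j : 'I_d, dotv (b i.+1) (b j.+1) = (i == j)%:R.
Hypothesis oab : forall i j : 'I_d, dotv (a i.+1) (b j.+1) = 0.

(* Rotation by the angle t_j in each oriented plane (a_j, b_j), 1 <= j <= d. *)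
Definition torus (t : 'rV[R]_d) (x : 'rV[R]_n) : 'rV[R]_n :=
  x + \sum_(j < d)
    (((cos (t 0 j) - 1) * dotv x (a j.+1) - sin (t 0 j) * dotv x (b j.+1)) *: a j.+1 +
     (sin (t 0 j) * dotv x (a j.+1) + (cos (t 0 j) - 1) * dotv x (b j.+1)) *: b j.+1).

Lemma dotv_pairs (f g : 'I_d -> R) (l : 'I_d) :
  dotv (\sum_(j < d) (f j *: a j.+1 + g j *: b j.+1)) (a l.+1) = f l /\
  dotv (\sum_(j < d) (f j *: a j.+1 + g j *: b j.+1)) (b l.+1) = g l.
Proof.
by split; rewrite dotv_suml (bigD1 l) //= big1 ?addr0 => [|i /negPf ne];
  rewrite !dotv_lin ?(dotvC (b _) (a _)) ?oa ?ob ?oab ?ne ?eqxx /=; ring.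
Qed.

Lemma torus_a t x (l : 'I_d) :
  dotv (torus t x) (a l.+1) = cos (t 0 l) * dotv x (a l.+1) - sin (t 0 l) * dotv x (b l.+1).
Proof.
rewrite /torus dotvDl (dotv_pairs (fun j => _) (fun j => _) l).1; ring.
Qed.

Lemma torus_b t x (l : 'I_d) :
  dotv (torus t x) (b l.+1) = sin (t 0 l) * dotv x (a l.+1) + cos (t 0 l) * dotv x (b l.+1).
Proof. rewrite /torus dotvDl (dotv_pairs (fun j => _) (fun j => _) l).2; ring. Qed.

Lemma torusD s t x : torus (s + t) x = torus s (torus t x).
Proof.
rewrite /torus -/(torus t x) {1}/torus -addrA -big_split /=; congr (x + _).
apply: eq_bigr => j _; rewrite torus_a torus_b !mxE cosD sinD.
by apply/rowP => i; rewrite !mxE; ring.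
Qed.

Lemma torus_id (t : 'rV[R]_d) x :
  (forall j, cos (t 0 j) = 1) -> (forall j, sin (t 0 j) = 0) -> torus t x = x.
Proof.
move=> c s; rewrite /torus big1 ?addr0 // => j _; rewrite c s subrr !mul0r subrr addr0.
by rewrite !scale0r addr0.
Qed.

Lemma continuous_torus x : continuous (fun t => torus t x).
Proof.
have ccos (j : 'I_d) : continuous (fun t : 'rV[R]_d => cos (t 0 j)).
  move=> t; apply: continuous_comp; first exact: (@coord_continuous R 1 d 0 j t).
  exact: continuous_cos.
have csin (j : 'I_d) : continuous (fun t : 'rV[R]_d => sin (t 0 j)).
  move=> t; apply: continuous_comp; first exact: (@coord_continuous R 1 d 0 j t).
  exact: continuous_sin.
have cst (p : R) (t : 'rV[R]_d) : {for t, continuous (fun _ : 'rV[R]_d => p)}.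
  exact: cst_continuous.
have ca (j : 'I_d) (p q : R) :
    continuous (fun t : 'rV[R]_d => (cos (t 0 j) - 1) * p - sin (t 0 j) * q).
  move=> t; exact: (continuousB
    (continuousM (continuousB (ccos j t) (cst 1 t)) (cst p t))
    (continuousM (csin j t) (cst q t))).
have cb (j : 'I_d) (p q : R) :
    continuous (fun t : 'rV[R]_d => sin (t 0 j) * p + (cos (t 0 j) - 1) * q).
  move=> t; exact: (continuousD (continuousM (csin j t) (cst p t))
    (continuousM (continuousB (ccos j t) (cst 1 t)) (cst q t))).
move=> t; apply: continuousD; first exact: cst_continuous.
apply: continuous_sum => j {}t.
exact: (continuousD (continuousZr_tmp (ca j _ _ t)) (continuousZr_tmp (cb j _ _ t))).
Qed.

(** In each plane [(a_j, b_j)] two line reflections with angle [al j] between the lines compose to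
    the rotation by twice that angle. Orthogonally to all planes both reflections are minus the
    identity, so they cancel. *)
Lemma reflv_comp_torus (al : nat -> R) (A C : 'M[R]_n) x :
  (A == lin [seq a j | j <- iota 1 d])%MS ->
  (C == lin [seq (cos (al j) *: a j + sin (al j) *: b j)%R | j <- iota 1 d])%MS ->
  reflv C (reflv A x) = torus (\row_j (al j.+1 *+ 2)) x.
Proof.
move=> AE CE; rewrite (@reflv_orthonormal _ _ _ _ _ C _ _ CE); last first.
  move=> i j; rewrite !dotv_lin (dotvC (b _) (a _)) !oa !ob !oab.
  have := cos2Dsin2 (al j.+1); case: eqVneq => [->|_] /= h; last by ring.
  by rewrite -[RHS]h; ring.
rewrite (reflv_orthonormal _ oa AE) /torus.
set y := _ *+ 2 - x.
have ya (l : 'I_d) : dotv y (a l.+1) = dotv x (a l.+1).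
  rewrite /y mulr2n dotvDl dotvDl dotvNl.
  have -> : dotv (\sum_(j < d) dotv x (a j.+1) *: a j.+1) (a l.+1) = dotv x (a l.+1).
    rewrite dotv_suml (bigD1 l) //= big1 ?addr0 => [|i /negPf ne].
      by rewrite dotvZl oa eqxx mulr1.
    by rewrite dotvZl oa ne mulr0.
  ring.
have yb (l : 'I_d) : dotv y (b l.+1) = - dotv x (b l.+1).
  rewrite /y mulr2n dotvDl dotvDl dotvNl.
  have -> : dotv (\sum_(j < d) dotv x (a j.+1) *: a j.+1) (b l.+1) = 0.
    by rewrite dotv_suml big1 // => i _; rewrite dotvZl oab mulr0.
  ring.
set B := \sum_(j < d) dotv x (a j.+1) *: a j.+1 in y ya yb *.
rewrite [X in _ = x + X](_ : _ = (\sum_(j < d)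
    dotv y (cos (al j.+1) *: a j.+1 + sin (al j.+1) *: b j.+1) *:
      (cos (al j.+1) *: a j.+1 + sin (al j.+1) *: b j.+1)) *+ 2 - B *+ 2).
  by rewrite /y opprB addrCA.
rewrite /B -!sumrMnl -sumrN -big_split /=; apply: eq_bigr => j _.
rewrite !dotvDr !dotvZr ya yb mxE cos_mulr2n sin_mulr2n.
have h : cos (al j.+1) ^+ 2 = 1 - sin (al j.+1) ^+ 2 by rewrite -(cos2Dsin2 (al j.+1)); ring.
apply/rowP => i; rewrite !mxE.
ring: h.
Qed.

End TorusAction.

(** * From simultaneous rotations to invariance under each single plane *)

Lemma unit_circle_angle (R : realType) (c s : R) :
  c ^+ 2 + s ^+ 2 = 1 -> exists t, cos t = c /\ sin t = s.
Proof.
move=> cs; have c1 : -1 <= c <= 1 by have s2 := sqr_ge0 s; apply/andP; split; nra.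
have sE : 1 - c ^+ 2 = s ^+ 2 by rewrite -cs; ring.
have [s0|s0] := leP 0 s.
  exists (acos c); rewrite acosK ?inE // sin_acos // sE sqrtr_sqr ger0_norm //.
exists (- acos c); rewrite cosN sinN acosK ?inE // sin_acos // sE sqrtr_sqr.
by rewrite ltr0_norm // opprK.
Qed.

Lemma plane_angle (R : realType) (p q p' q' : R) :
  p ^+ 2 + q ^+ 2 = p' ^+ 2 + q' ^+ 2 ->
  exists t, cos t * p - sin t * q = p' /\ sin t * p + cos t * q = q'.
Proof.
move=> h; have [r0|r0] := eqVneq (p ^+ 2 + q ^+ 2) 0.
  have sq0 (y z : R) : y ^+ 2 + z ^+ 2 = 0 -> y = 0 /\ z = 0.
    move=> /eqP; rewrite paddr_eq0 ?sqr_ge0 // !sqrf_eq0.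
    by case/andP => /eqP -> /eqP ->.
  have [-> ->] := sq0 _ _ r0; have [|-> ->] := sq0 p' q'; first by rewrite -h.
  by exists 0; rewrite !mulr0 subrr addr0.
(* Cosine and sine are the real and imaginary parts of the quotient of [p' + i q'] by [p + i q]. *)
have [|t [ct st]] := @unit_circle_angle R ((p * p' + q * q') / (p ^+ 2 + q ^+ 2))
  ((p * q' - q * p') / (p ^+ 2 + q ^+ 2)).
  rewrite !expr_div_n -mulrDl; apply: (mulIf (expf_neq0 2 r0)).
  rewrite divfK ?expf_neq0 // mul1r [RHS]expr2 {2}h; ring.
by exists t; rewrite ct st; split; field.
Qed.

(** The rotation vectors preserving [E] form a closed group containing the full turns and, since the
    two signs [eps] cancel, the angles [2 * al j]. By [kronecker] it contains every rotation of
    plane [l] alone, and such a rotation, with an angle depending on [x], sends [x] to its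
    reflection along [v]. *)
Lemma plane_hrefl_inv (R : realType) n d (a b : nat -> 'rV[R]_n) (al : nat -> R)
    (A C : 'M[R]_n) (E : set 'rV[R]_n) (eps : R) :
  (forall i j : 'I_d, dotv (a i.+1) (a j.+1) = (i == j)%:R) ->
  (forall i j : 'I_d, dotv (b i.+1) (b j.+1) = (i == j)%:R) ->
  (forall i j : 'I_d, dotv (a i.+1) (b j.+1) = 0) ->
  (A == lin [seq a j | j <- iota 1 d])%MS ->
  (C == lin [seq (cos (al j) *: a j + sin (al j) *: b j)%R | j <- iota 1 d])%MS ->
  (forall (q0 : rat) (q : 'I_d -> rat),
     ratr q0 * pi + \sum_j ratr (q j) * al j.+1 = 0 -> forall j, q j = 0) ->
  closed E -> eps ^+ 2 = 1 ->
  (forall x, E x <-> E (eps *: reflv A x)) ->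
  (forall x, E x <-> E (eps *: reflv C x)) ->
  forall l : 'I_d, hrefl_inv E (a l.+1 + b l.+1)%MS.
Proof.
move=> oa ob oab AE CE indep Ecl eps1 EA EC l.
pose rt := @torus R n d a b.
have rtD := torusD oa ob oab.
pose t0 : 'rV[R]_d := \row_j (al j.+1 *+ 2).
have Et0 x : E x <-> E (rt t0 x).
  rewrite /rt -(reflv_comp_torus oa ob oab _ AE CE) EA EC !reflvE.
  by rewrite -scalemxAl scalerA -expr2 eps1 scale1r.
(* Angles are measured in full turns. Requiring both [s] and its opposite makes [S] closed under
   subtraction, and each requirement is a closed preimage of [E]. *)
pose S := \bigcap_(x in E)
  ([set s : 'rV[R]_d | E (rt (s *m (pi *+ 2)%:M) x)] `&`
   [set s : 'rV[R]_d | E (rt (s *m (- (pi *+ 2))%:M) x)]).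
have crt x (k : R) : continuous (fun s : 'rV[R]_d => rt (s *m k%:M) x).
  move=> s; exact: (continuous_comp (@continuous_mulmxr R d d k%:M s)
    (@continuous_torus R n d a b x _)).
have SP (s : 'rV[R]_d) : S s <->
    forall x, E x -> E (rt ((pi *+ 2) *: s) x) /\ E (rt (- (pi *+ 2) *: s) x).
  by split=> h x Ex; have := h x Ex; rewrite /= !mul_mx_scalar.
have Scl : closed S.
  apply: closed_bigI => x _; apply: closedI.
    apply: (@preimage_closed _ _ (fun s : 'rV[R]_d => rt (s *m (pi *+ 2)%:M) x) E)
      => // s _; exact: crt.
  apply: (@preimage_closed _ _ (fun s : 'rV[R]_d => rt (s *m (- (pi *+ 2))%:M) x) E)
    => // s _; exact: crt.
have SB s t : S s -> S t -> S (s - t).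
  move=> /SP Ss /SP St; apply/SP => x Ex; split.
    by rewrite scalerBr -scaleNr /rt rtD; apply: (Ss _ _).1; exact: (St _ _).2.
  rewrite scalerBr -scaleNr opprK /rt rtD; apply: (Ss _ _).2; exact: (St _ _).1.
have Sdelta j : S (delta_mx 0 j).
  by apply/SP => x Ex; rewrite /rt !torus_id // => i; rewrite !mxE eqxx /=;
    case: eqP => _; rewrite ?mulr1 ?mulr0 ?cosN ?sinN ?cos0 ?sin0 ?cos2pi ?sin2pi ?oppr0.
have pi0 : pi != 0 :> R by rewrite gt_eqF // pi_gt0.
have Sb : S (\row_j (al j.+1 / pi)).
  apply/SP => x Ex.
  have -> : (pi *+ 2) *: (\row_j (al j.+1 / pi)) = t0.
    by apply/rowP => j; rewrite /t0 !mxE; move: (@pi R) pi0 => P P0; field.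
  have -> : - (pi *+ 2) *: (\row_j (al j.+1 / pi)) = - t0.
    by apply/rowP => j; rewrite /t0 !mxE; move: (@pi R) pi0 => P P0; field.
  split; first exact: (Et0 x).1.
  (* The rotation by [- t0] is handled by the converse half of [Et0]: rotating its result by [t0]
     gives back [x]. *)
  by apply: (Et0 _).2; rewrite /rt -rtD subrr torus_id // => j; rewrite mxE ?cos0 ?sin0.
have Sall : forall s, S s.
  apply: (kronecker Scl SB Sdelta Sb) => q0 q h; apply: (indep q0).
  have := congr1 (fun z => z * pi) h; rewrite mul0r mulrDl mulr_suml => {2}<-.
  congr (_ + _); apply: eq_bigr => j _; rewrite mxE; by rewrite mulrA divfK.
move=> v /sub_addsmxP [[y z] /= vE] x Ex.
have {y z vE} [s [t vE]] : exists s t, v = s *: a l.+1 + t *: b l.+1.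
  exists (y 0 0), (z 0 0).
  by rewrite vE {1}[y]mx11_scalar {1}[z]mx11_scalar !mul_scalar_mx.
pose k := 2 * dotv x v / dotv v v.
pose p := dotv x (a l.+1); pose q := dotv x (b l.+1).
have vv : dotv v v = s ^+ 2 + t ^+ 2.
  by rewrite vE !dotv_lin (dotvC (b _) (a _)) oa ob oab eqxx /=; ring.
have xv : dotv x v = s * p + t * q by rewrite vE !dotv_lin.
have [th [thp thq]] : exists th, cos th * p - sin th * q = p - k * s /\
    sin th * p + cos th * q = q - k * t.
  apply: plane_angle; rewrite /k vv xv.
  (* If [v = 0], then [k = 0] because the inverse of 0 is 0. *)
  have [st0|st0] := eqVneq (s ^+ 2 + t ^+ 2) 0; last by field.
  by rewrite st0 invr0 mulr0 !mul0r !subr0.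
have /SP/(_ x Ex) [+ _] := Sall (\row_j (if j == l then th / (pi *+ 2) else 0)).
congr (E _); rewrite /rt /torus (bigD1 l) //= big1 => [|j /negPf ne].
  rewrite addr0 !mxE eqxx (_ : pi *+ 2 * _ = th); last by move: (@pi R) pi0 => P P0; field.
  rewrite /hrefl -/k -/p -/q vE; apply/rowP => i; rewrite !mxE.
  have -> : (cos th - 1) * p - sin th * q = - (k * s) by rewrite mulrBl mul1r addrAC thp; ring.
  have -> : sin th * p + (cos th - 1) * q = - (k * t) by rewrite mulrBl mul1r addrA thq; ring.
  by ring.
by rewrite !mxE ne mulr0 cos0 sin0 subrr !mul0r subrr addr0 !scale0r addr0.
Qed.

(** * Adding a subspace *)

(** The map [V^T] is injective on [M], its kernel there being the trivial intersection. It factors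
    through the transpose of [V *m projmx M], so the projection of [V] into [M] has full rank. *)
Lemma sub_proj_of_capmx_orthc (R : realType) n m p (M : 'M[R]_(m, n)) (V : 'M[R]_(p, n)) :
  \rank (M :&: orthc V)%MS = 0%N -> (M <= V *m projmx M)%MS.
Proof.
move=> MV0; have MP : M *m projmx M = M.
  apply/row_matrixP => i; rewrite row_mul; apply: (@projv_uniq _ _ _ M); first exact: row_sub.
  by rewrite subrr mul0mx.
have VPM : (V *m projmx M <= M)%MS.
  by apply/row_subP => i; rewrite row_mul; exact: projv_sub.
rewrite -(geq_leqif (mxrank_leqif_sup VPM)).
have := mxrank_mul_ker M V^T; rewrite -/(orthc V) MV0 addn0 => <-.
rewrite -{1}MP -mulmxA -[\rank (V *m _)]mxrank_tr trmx_mul tr_projmx.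
exact: mxrankM_maxr.
Qed.

Lemma hrefl_inv_add_reflv (R : realType) n m p (E : set 'rV[R]_n) (eps : R)
    (M : 'M[R]_(m, n)) (V : 'M[R]_(p, n)) :
  closed E -> eps ^+ 2 = 1 -> (forall x, E x <-> E (eps *: reflv M x)) ->
  (\rank M < \rank V)%N -> \rank (M :&: orthc V)%MS = 0%N ->
  hrefl_inv E V -> hrefl_inv E (V + M)%MS.
Proof.
move=> Ecl eps1 EM ltMV MV0 EV.
pose Q := eps *: reflmx M.
have QQ : Q *m Q^T = 1%:M.
  by rewrite /Q linearZ /= tr_reflmx -scalemxAl -scalemxAr reflmxK scalerA -expr2 eps1 scale1r.
have EVQ : hrefl_inv E (V *m Q).
  by apply: hrefl_inv_mulmx QQ _ EV => x; rewrite EM reflvE scalemxAr.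
(* Projecting [V] to [M] cannot be injective, as [M] has smaller rank. *)
have /rowV0Pn [u] : (V :&: orthc M)%MS != 0.
  rewrite -mxrank_eq0; apply/eqP => r0.
  have := mxrank_mul_ker V M^T; rewrite -/(orthc M) r0 addn0 => rV.
  by move: ltMV; rewrite -rV ltnNge -[\rank M]mxrank_tr mxrankM_maxr.
rewrite sub_capmx => /andP [uV /sub_kermxP uM] u0.
have uQ : (u <= V *m Q)%MS.
  (* The reflection in [M] negates [u], which is orthogonal to [M]. *)
  have -> : u = (- eps *: u) *m Q.
    rewrite /Q -scalemxAl -scalemxAr scalerA -reflvE /reflv.
    rewrite (@projv_uniq _ _ _ M u 0) ?sub0mx ?subr0 //.
    by rewrite mul0rn sub0r scalerN mulNr -expr2 eps1 scaleN1r opprK.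
  by apply: submxMr; exact: scalemx_sub.
apply: hrefl_inv_sub (hrefl_inv_adds Ecl EV EVQ u0 uV uQ).
rewrite addsmx_sub addsmxSl /=; apply: submx_trans (sub_proj_of_capmx_orthc MV0) _.
(* The projection is the mean of the identity and the reflection [eps *: Q]. *)
have -> : V *m projmx M = 2^-1 *: (V + eps *: (V *m Q)).
  rewrite /Q /reflmx -scalemxAr scalerA -expr2 eps1 scale1r mulmxBr mulmx1 addrC subrK.
  rewrite [projmx M *+ 2]mulr2n mulmxDr -[_ + _]mulr2n.
  by rewrite -(scaler_nat 2 (V *m projmx M)) scalerA mulVf ?scale1r // pnatr_eq0.
apply: scalemx_sub; apply: addmx_sub; first exact: addsmxSl.
by apply: scalemx_sub; exact: addsmxSr.
Qed.

(* The real-valued hypotheses are cleared because [lia] is very slow on them. *)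
Ltac arith :=
  repeat match goal with H : ?T |- _ =>
    match type of T with Prop =>
      lazymatch T with
      | is_true (leq _ _) => fail
      | is_true (leq _ _ && leq _ _) => fail
      | is_true (negb _) => fail
      | is_true (odd _) => fail
      | @eq nat _ _ => fail
      | ~ (@eq nat _ _) => fail
      | @eq (Equality.sort _) _ _ => fail
      | ~ (@eq (Equality.sort _) _ _) => fail
      | _ => clear H
      end
    end
  end; lia.

(** * Chaining the planes and adding the remaining subspaces *)

Theorem theorem3p8 (R : realType) (n k i d : nat)
  (H : nat -> 'M[R]_n) (M : nat -> 'M[R]_n)
  (e : nat -> 'rV[R]_n) (alpha : nat -> R) (E : set 'rV[R]_n) :
  (3 <= k)%N -> (1 <= i)%N -> (i <= n - 2)%N ->
  (forall j, (1 <= j <= k)%N -> \rank (H j) = i) ->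
  (* choice of d and M_j *)
  (((2 <= i)%N /\ (2 * i <= n)%N /\ d = i /\ (forall j, M j = H j)) \/
  ((n < 2 * i)%N /\ d = (n - i)%N /\ (forall j, M j = orthc (H j)))) ->
  (* (i) *)
  (forall a b, (1 <= a <= n)%N -> (1 <= b <= n)%N ->
     dotv (e a) (e b) = (a == b)%:R) ->
  0 < alpha 1 ->
  (forall j, (1 <= j < d)%N -> alpha j < alpha j.+1) ->
  alpha d < pi / 2 ->
  (forall (c0 : rat) (c : nat -> rat),
     ratr c0 * pi + \sum_(1 <= j < d.+1) ratr (c j) * alpha j = 0 ->
     c0 = 0 /\ forall j, (1 <= j <= d)%N -> c j = 0) ->
  (M 1 == lin [seq e (2 * j - 1)%N | j <- iota 1 d])%MS ->
  (M 2 == lin [seq (cos (alpha j) *: e (2 * j - 1)%N + sin (alpha j) *: e (2 * j)%N)%R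
               | j <- iota 1 d])%MS ->
  (M 3 == lin ((cos (alpha 1) *: e 1 + sin (alpha 1) *: e (2 * d)%N)%R ::
               [seq (cos (alpha j) *: e (2 * j - 1)%N + sin (alpha j) *: e (2 * j - 2)%N)%R
               | j <- iota 2 (d - 1)]))%MS ->
  (* (ii) *)
  (\sum_(1 <= j < k.+1) M j == 1%:M)%MS ->
  (* (iii) *)
  (forall j, (3 <= j <= k - 1)%N ->
     \rank (M j.+1 :&: orthc (\sum_(1 <= l < j.+1) M l)%MS)%MS = 0%N) ->
  (* conclusion *)
  E !=set0 -> E `<=` @sphere R n -> closed E ->
  (forall j, (1 <= j <= k)%N -> reflv (H j) @` E = E) ->
  E = @sphere R n.
Proof.
move=> k3 i1 i2 Hrank dM he al1 almono ald indep M1 M2 M3 Msum Mcap E0 Es Ecl EH.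
have [eps [eps1 epsE]] : exists eps : R, eps ^+ 2 = 1 /\
    forall j x, reflv (H j) x = eps *: reflv (M j) x.
  case: dM => [[_ [_ [_ ME]]]|[_ [_ ME]]].
    by exists 1; split=> [|j x]; [rewrite expr1n | rewrite scale1r ME].
  exists (-1); split=> [|j x]; first by rewrite sqrrN expr1n.
  by rewrite ME reflv_orthc scaleN1r opprK.
have [d2 dn] : (2 <= d)%N /\ (2 * d <= n)%N.
  by clear -i1 i2 dM; case: dM => [[? [? [? _]]]|[? [? _]]]; split; lia.
have Mrank j : (1 <= j <= k)%N -> \rank (M j) = d.
  move=> /Hrank; case: dM => [[_ [_ [-> ->]]]|[_ [-> ->]]] //.
  by rewrite /orthc mxrank_ker mxrank_tr => ->.
have EM j : (1 <= j <= k)%N -> forall x, E x <-> E (eps *: reflv (M j) x).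
  move=> jk; have EMs x : E x -> E (eps *: reflv (M j) x).
    by move=> Ex; rewrite -epsE -(EH j jk); exists x.
  move=> x; split=> [|/EMs]; first exact: EMs.
  by rewrite !reflvE -scalemxAl scalerA -expr2 eps1 scale1r -mulmxA reflmxK mulmx1.
have indep' (q0 : rat) (q : 'I_d -> rat) :
    ratr q0 * pi + \sum_j ratr (q j) * alpha j.+1 = 0 -> forall j, q j = 0.
  (* [indep] takes coefficients on natural numbers, so [q] is shifted by one and extended by 0. *)
  move=> h j; have [|_ /(_ j.+1)] := indep q0 (fun l => oapp q 0 (insub l.-1)).
    rewrite big_add1 big_mkord -[RHS]h; congr (_ + _).
    by apply: eq_bigr => l _; rewrite /= valK.
  by rewrite /= valK; apply; exact: ltn_ord.
have oe s t : (1 <= s <= n)%N -> (1 <= t <= n)%N -> dotv (e s) (e t) = (s == t)%:R by exact: he.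
(* The exceptional first generator of [M 3], which uses [e (2 * d)], is fitted into the same indexed
   family as the others. *)
pose b3 j := if j == 1%N then e (2 * d)%N else e (2 * j - 2)%N.
have M3' : (M 3 == lin [seq (cos (alpha j) *: e (2 * j - 1)%N + sin (alpha j) *: b3 j)%R
    | j <- iota 1 d])%MS.
  have -> : [seq (cos (alpha j) *: e (2 * j - 1)%N + sin (alpha j) *: b3 j)%R | j <- iota 1 d] =
     (cos (alpha 1) *: e 1 + sin (alpha 1) *: e (2 * d)%N)%R ::
               [seq (cos (alpha j) *: e (2 * j - 1)%N + sin (alpha j) *: e (2 * j - 2)%N)%R
               | j <- iota 2 (d - 1)].
    have -> : iota 1 d = 1%N :: iota 2 (d - 1) by rewrite -[d in LHS](subnK (ltnW d2)) addn1.
    rewrite /=; congr (_ :: _); apply/eq_in_map => j; rewrite mem_iota /b3 => jd.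
    by rewrite ifF //; apply/eqP; arith.
  exact: M3.
have plane2 := plane_hrefl_inv (n := n) (d := d) (a := fun j => e (2 * j - 1)%N)
  (b := fun j => e (2 * j)%N) (al := alpha) (A := M 1) (C := M 2) (E := E) (eps := eps).
have plane3 := plane_hrefl_inv (n := n) (d := d) (a := fun j => e (2 * j - 1)%N)
  (b := b3) (al := alpha) (A := M 1) (C := M 3) (E := E) (eps := eps).
have oa (s t : 'I_d) : dotv (e (2 * s.+1 - 1)%N) (e (2 * t.+1 - 1)%N) = (s == t)%:R.
  rewrite oe; try (have := ltn_ord s; have := ltn_ord t; arith).
  by apply: (congr1 (fun c : bool => c%:R)); rewrite -val_eqE /=; apply/eqP/eqP; arith.
have {}plane2 : forall l : 'I_d, hrefl_inv E (e (2 * l.+1 - 1)%N + e (2 * l.+1)%N)%MS.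
  apply: plane2 => // [s t|s t||].
  - rewrite oe; try (have := ltn_ord s; have := ltn_ord t; arith).
    by apply: (congr1 (fun c : bool => c%:R)); rewrite -val_eqE /=; apply/eqP/eqP; arith.
  - rewrite oe; try (have := ltn_ord s; have := ltn_ord t; arith).
    by rewrite (_ : _ == _ = false) //; apply/eqP; arith.
  - by apply: EM; arith.
  - by apply: EM; arith.
have {}plane3 : forall l : 'I_d, hrefl_inv E (e (2 * l.+1 - 1)%N + b3 l.+1)%MS.
  apply: plane3 => // [s t|s t||].
  - rewrite /b3; have := ltn_ord s; have := ltn_ord t => ltt lts.
    case: eqP => s0; case: eqP => t0; rewrite oe; try arith;
    by apply: (congr1 (fun c : bool => c%:R)); rewrite -val_eqE /=; apply/eqP/eqP; arith.
  - rewrite /b3; have := ltn_ord s; have := ltn_ord t => ltt lts.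
    case: eqP => t0; rewrite oe; try arith;
    by rewrite (_ : _ == _ = false) //; apply/eqP; arith.
  - by apply: EM; arith.
  - by apply: EM; arith.
(* An odd [t] is some [2 * j - 1], giving a plane from [M 2]; for even [t] it is [t.+1] that has
   this form, giving a plane from [M 3] with [j >= 2]. *)
have consecutive t : (1 <= t < 2 * d)%N -> hrefl_inv E (e t + e t.+1)%MS.
  move=> td; have ltd : (t./2 < d)%N by arith.
  have [todd|teven] := boolP (odd t).
    have := plane2 (Ordinal ltd) => /=.
    by rewrite (_ : 2 * t./2.+1 - 1 = t)%N 1?(_ : 2 * t./2.+1 = t.+1)%N //; arith.
  have := plane3 (Ordinal ltd); rewrite /b3 /= ifF; last by apply/eqP; arith.
  rewrite (_ : 2 * t./2.+1 - 1 = t.+1)%N 1?(_ : 2 * t./2.+1 - 2 = t)%N; try arith.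
  by apply: hrefl_inv_sub; rewrite addsmxC.
have e_neq0 t : (1 <= t <= n)%N -> e t != 0.
  by move=> tn; rewrite -dotv_eq0 oe // eqxx oner_eq0.
have span t : (2 <= t <= 2 * d)%N ->
    exists2 W : 'M[R]_n, hrefl_inv E W & forall s, (1 <= s <= t)%N -> (e s <= W)%MS.
  elim: t => // t ih td; have [t1|t2] := leqP t 1.
    have -> : t = 1%N by arith.
    exists (e 1 + e 2)%MS; first by apply: consecutive; arith.
    move=> s s2; have [->|->] : s = 1%N \/ s = 2 by arith.
      exact: addsmxSl.
    exact: addsmxSr.
  have [|W EW eW] := ih; first by arith.
  exists (W + (e t + e t.+1))%MS.
    apply: (hrefl_inv_adds (u := e t)) => //.
    - by apply: consecutive; arith.
    - by apply: e_neq0; arith.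
    - by apply: eW; arith.
    - exact: addsmxSl.
  move=> s /andP [s1]; rewrite leq_eqVlt => /orP [/eqP ->|st].
    by apply: submx_trans (addsmxSr _ _); exact: addsmxSr.
  by apply: submx_trans (addsmxSl _ _); apply: eW; arith.
have [|W EW eW] := span (2 * d)%N; first by arith.
have MW (f : nat -> 'rV[R]_n) (A : 'M[R]_n) :
    (A == lin [seq f j | j <- iota 1 d])%MS ->
    (forall j, (1 <= j <= d)%N -> (f j <= W)%MS) -> (A <= W)%MS.
  move=> /andP [Alin _] fW; apply: submx_trans Alin _.
  by apply: lin_sub => _ /mapP [j + ->]; rewrite mem_iota => jd; apply: fW; arith.
have M1W : (M 1 <= W)%MS by apply: (MW _ _ M1) => j jd; apply: eW; arith.
have M2W : (M 2 <= W)%MS.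
  by apply: (MW _ _ M2) => j jd; apply: addmx_sub; apply: scalemx_sub; apply: eW; arith.
have M3W : (M 3 <= W)%MS.
  apply: (MW _ _ M3') => j jd; apply: addmx_sub; apply: scalemx_sub;
    rewrite /b3; try case: eqP => ?; apply: eW; arith.
have al_le j : (1 <= j <= d)%N -> alpha 1 <= alpha j.
  elim: j => // j ih jd; have [->//|j0] := eqVneq j 0%N.
  by apply: le_trans (ih _) (ltW (almono _ _)); arith.
have sin0 : 0 < sin (alpha 1).
  apply: sin_gt0_pi; apply/andP; split=> //.
  have := al_le d; have := pi_gt0 R; have -> : (1 <= d <= d)%N by arith.
  by move=> ? /(_ isT) ?; lra.
(* Otherwise [V] equals [M 1] and contains [M 2]; but [e 2] is orthogonal to [M 1] and has inner
   product [sin (alpha 1) > 0] with the first generator of [M 2]. *)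
have rank_gt (V : 'M[R]_n) : (M 1 <= V)%MS -> (M 2 <= V)%MS -> (d < \rank V)%N.
  move=> M1V M2V; rewrite ltnNge; apply/negP => Vd.
  have VM1 : (V <= M 1)%MS by rewrite -(geq_leqif (mxrank_leqif_sup M1V)) Mrank //; arith.
  case/andP: M1 => M1lin _; case/andP: M2 => _ linM2.
  have cM1 : ((cos (alpha 1) *: e 1 + sin (alpha 1) *: e 2)%R <=
      lin [seq e (2 * j - 1)%N | j <- iota 1 d])%MS.
    apply: submx_trans _ (submx_trans (submx_trans M2V VM1) M1lin).
    apply: submx_trans _ linM2; apply: sub_lin; apply/mapP; exists 1%N => //.
    by rewrite mem_iota; arith.
  have := dotv_sub_orth _ cM1 (x := e 2).
  rewrite !dotv_lin !oe; try arith.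
  rewrite /= mulr0 add0r mulr1 => h; move: sin0; rewrite h ?ltxx //.
  apply: lin_orth => x /mapP [j + ->]; rewrite mem_iota => jd.
  by rewrite oe; try arith; rewrite (_ : _ == _ = false) //; apply/eqP; arith.
have Msub l j : (1 <= l < j)%N -> (M l <= \sum_(1 <= s < j) M s)%MS.
  move=> lj; rewrite (big_cat_nat (n := l)) /=; try arith.
  rewrite (@big_ltn _ _ _ l); last by arith.
  by apply: submx_trans (addsmxSr _ _); exact: addsmxSl.
have main j : (3 <= j <= k)%N -> hrefl_inv E (\sum_(1 <= l < j.+1) M l)%MS.
  elim: j => // j ih jk; have [j2|j3] := leqP j 2.
    (* The induction starts from the sum of [M 1], [M 2] and [M 3], which lies in [W]. *)
    have -> : j = 2 by arith.
    apply: hrefl_inv_sub EW; rewrite big_add1 big_mkord.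
    by apply/sumsmx_subP => -[[|[|[|l]]] ?] _.
  rewrite big_nat_recr //=; apply: (hrefl_inv_add_reflv Ecl eps1).
  - by apply: EM; arith.
  - by rewrite Mrank ?rank_gt ?Msub //; arith.
  - by apply: Mcap; arith.
  - by apply: ih; arith.
apply: hrefl_inv_sphere E0 Es _.
case/andP: Msum => _ oneM.
by apply: hrefl_inv_sub oneM _; apply: main; arith.
Qed.
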